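(* Suppose that $R$ is a weakly $2$-primal periodic ring. Then the full matrix ring $\mathbb{M}_n(R)$ is periodic for all $n\ge 1$.
   Context: All rings are associative with identity (not necessarily commutative). A ring $R$ is periodic if for every $x\in R$ there exist distinct positive integers $m\neq n$ with $x^m=x^n$. $\mathrm{Nil}(R)$ denotes the set of nilpotent elements of $R$, and the Levitzki radical $L\text{-}rad(R)$ is the largest locally nilpotent two-sided ideal of $R$ (an ideal is locally nilpotent if for every finite subset of it there is a natural number $N$ such that every product of $N$ elements from this subset is zero). $R$ is weakly $2$-primal if $\mathrm{Nil}(R)=L\text{-}rad(R)$. *)

(* Defs.v *)
From HB Require Import structures.
From mathcomp Require Import all_boot all_order all_algebra.

Set Implicit Arguments.
Unset Strict Implicit.
Unset Printing Implicit Defensive.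

Import GRing.Theory.
Local Open Scope ring_scope.

(* Rings are associative and unital, not necessarily commutative; the zero
   ring is allowed, hence [pzRingType] rather than [nzRingType].  Subsets of a
   ring are [Prop]-valued, so that they need not be decidable. *)

Definition periodic (R : pzRingType) : Prop :=
  forall x : R, exists m n : nat,
    [/\ (0 < m)%N, (0 < n)%N, m <> n & x ^+ m = x ^+ n].

Definition Nil (R : pzRingType) (x : R) : Prop :=
  exists n : nat, (0 < n)%N /\ x ^+ n = 0.

Definition two_sided_ideal (R : pzRingType) (I : R -> Prop) : Prop :=
  [/\ I 0,
      forall x y : R, I x -> I y -> I (x - y),
      forall a x : R, I x -> I (a * x)
    & forall a x : R, I x -> I (x * a)].

(* Factors may be repeated, and are multiplied in the order of [t]. *)
Definition locally_nilpotent (R : pzRingType) (I : R -> Prop) : Prop :=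
  forall s : seq R, (forall x, x \in s -> I x) ->
    exists N : nat, (0 < N)%N /\
      forall t : N.-tuple R, {subset t <= s} -> \prod_(x <- t) x = 0.

Definition is_Levitzki_radical (R : pzRingType) (L : R -> Prop) : Prop :=
  [/\ two_sided_ideal L, locally_nilpotent L
    & forall I : R -> Prop, two_sided_ideal I -> locally_nilpotent I ->
        forall x, I x -> L x].

Definition weakly_2_primal (R : pzRingType) : Prop :=
  exists L : R -> Prop,
    is_Levitzki_radical L /\ forall x : R, Nil x <-> L x.

(* Main.v *)
Require Import Defs.
From HB Require Import structures.
From mathcomp Require Import all_boot all_order all_algebra.
From mathcomp Require Import boolp finfield.

Set Implicit Arguments.
Unset Strict Implicit.
Unset Printing Implicit Defensive.

Import GRing.Theory.
Local Open Scope ring_scope.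
Local Open Scope quotient_scope.

(** By Jacobson's theorem the quotient of [R] by its nil radical, in which every
    [x] satisfies [x ^+ k = x] for some [k > 1], is commutative, so its finitely
    generated subrings are finite.  Hence two powers [A ^+ p] and [A ^+ q] of a
    matrix agree modulo [Nil R], their difference [D] is nilpotent because
    [Nil R] is locally nilpotent, and since [R] has positive characteristic [c],
    raising [A ^+ q = A ^+ p + D] to the power [c * K`!] with [D ^+ K = 0] kills
    every binomial term containing [D].

    Jacobson's theorem is obtained without structure theory.  If [x] and [y] do
    not commute, the finite subring generated by [x] becomes a field [F] after
    dividing by annihilators of central idempotents, while [x] and [y] still do
    not commute.  Then some [w <> 0] satisfies [w * x = c * w] with [c] in [F],
    [c <> x].  The subring generated by [F] and [w] is finite, so a second such
    quotient turns it into a field, by Wedderburn, in which [w] and [x] still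
    do not commute. *)

(** * Quotient of a ring by a two-sided ideal *)

Section IdealQuotient.

Variables (R : pzRingType) (I : R -> Prop).
Hypothesis idI : two_sided_ideal I.

(* The proof is a parameter so that the closure instance on it can use it. *)
Definition ideal_pred (_ : two_sided_ideal I) : {pred R} := fun x => `[< I x >].
Local Notation P := (ideal_pred idI).

Lemma ideal_zmod_closed : zmod_closed P.
Proof.
have [I0 IB _ _] := idI; split; first exact/asboolP.
by move=> x y /asboolP Ix /asboolP Iy; apply/asboolP/IB.
Qed.

HB.instance Definition _ := GRing.isZmodClosed.Build R P ideal_zmod_closed.

Definition quotient_ring := Quotient.quot P.
HB.instance Definition _ := GRing.Zmodule.on quotient_ring.
HB.instance Definition _ := EqQuotient.on quotient_ring.

Definition quotient_map (x : R) : quotient_ring := \pi_quotient_ring x.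
Local Notation pi := quotient_map.

Lemma eq_quotient (x y : R) : pi x = pi y <-> I (x - y).
Proof.
split=> [/eqP|Ixy]; first by rewrite -Quotient.idealrBE => /asboolP.
by apply/eqP; rewrite -Quotient.idealrBE; apply/asboolP.
Qed.

Lemma quotient_repr (q : quotient_ring) : {x | q = pi x}.
Proof. by exists (repr q); rewrite /pi reprK. Qed.

Definition quotient_mul (p q : quotient_ring) : quotient_ring :=
  pi (repr p * repr q).

(** Independence of the chosen representatives: the two products differ by
    [x' * (y' - y) - (x - x') * y], so absorption on both sides is used. *)
Lemma pi_mul (x y : R) : pi (x * y) = quotient_mul (pi x) (pi y).
Proof.
apply/esym/eq_quotient; have [I0 IB Il Ir] := idI.
set x' := repr _; set y' := repr _.
have Ix : I (x' - x) by apply/eq_quotient; rewrite /pi reprK.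
have Iy : I (y' - y) by apply/eq_quotient; rewrite /pi reprK.
have -> : x' * y' - x * y = x' * (y' - y) - (x - x') * y.
  by rewrite mulrBr mulrBl opprB addrA subrK.
by apply: (IB); [exact: Il | apply: Ir; rewrite -opprB -sub0r; apply: IB].
Qed.

Lemma pi_add (x y : R) : pi (x + y) = pi x + pi y.
Proof. by rewrite /pi; exact: Quotient.pi_add. Qed.

Lemma quotient_mulA : associative quotient_mul.
Proof.
move=> p q r; have [x ->] := quotient_repr p; have [y ->] := quotient_repr q.
by have [z ->] := quotient_repr r; rewrite -!pi_mul mulrA.
Qed.

Lemma quotient_mul1l : left_id (pi 1) quotient_mul.
Proof. by move=> p; have [x ->] := quotient_repr p; rewrite -pi_mul mul1r. Qed.

Lemma quotient_mul1r : right_id (pi 1) quotient_mul.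
Proof. by move=> p; have [x ->] := quotient_repr p; rewrite -pi_mul mulr1. Qed.

Lemma quotient_mulDl : left_distributive quotient_mul +%R.
Proof.
move=> p q r; have [x ->] := quotient_repr p; have [y ->] := quotient_repr q.
by have [z ->] := quotient_repr r; rewrite -!(pi_add, pi_mul) mulrDl.
Qed.

Lemma quotient_mulDr : right_distributive quotient_mul +%R.
Proof.
move=> p q r; have [x ->] := quotient_repr p; have [y ->] := quotient_repr q.
by have [z ->] := quotient_repr r; rewrite -!(pi_add, pi_mul) mulrDr.
Qed.

HB.instance Definition _ := GRing.Zmodule_isPzRing.Build quotient_ring
  quotient_mulA quotient_mul1l quotient_mul1r quotient_mulDl quotient_mulDr.

Lemma pi_zmod_morphism : zmod_morphism pi.
Proof. by move=> x y; apply: (addIr (pi y)); rewrite -pi_add !subrK. Qed.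

Lemma pi_monoid_morphism : monoid_morphism pi.
Proof. by split=> // x y; rewrite pi_mul. Qed.

HB.instance Definition _ :=
  GRing.isZmodMorphism.Build R quotient_ring pi pi_zmod_morphism.
HB.instance Definition _ :=
  GRing.isMonoidMorphism.Build R quotient_ring pi pi_monoid_morphism.

(** Later arguments see the quotient only through its kernel and surjectivity. *)
Lemma quotient_ring_exists :
  exists (Q : pzRingType) (f : {rmorphism R -> Q}),
    (forall x, f x = 0 <-> I x) /\ (forall q, exists x, q = f x).
Proof.
exists quotient_ring, pi; split=> [x|q]; last first.
  by have [x ->] := quotient_repr q; exists x.
by rewrite -(rmorph0 pi) -[X in I X]subr0; exact: eq_quotient.
Qed.

End IdealQuotient.

(** * Subrings as predicates, and potent rings *)

Definition is_subring (R : pzRingType) (P : R -> Prop) : Prop :=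
  [/\ P 1, forall x y, P x -> P y -> P (x - y)
    & forall x y, P x -> P y -> P (x * y)].

Definition potent_ring (R : pzRingType) : Prop :=
  forall x : R, exists k : nat, x ^+ k.+2 = x.

Section SubringTheory.

Variables (R : pzRingType) (P : R -> Prop).
Hypothesis sP : is_subring P.

Lemma subring_0 : P 0.
Proof. by have [P1 PB _] := sP; rewrite -(subrr 1); apply: PB. Qed.

Lemma subring_add x y : P x -> P y -> P (x + y).
Proof.
move=> Px Py; have [_ PB _] := sP.
by rewrite -[y]opprK -[- y]sub0r; apply: (PB) => //;
  apply: PB => //; exact: subring_0.
Qed.

Lemma subring_exp x n : P x -> P (x ^+ n).
Proof.
move=> Px; have [P1 _ PM] := sP.
by elim: n => [|n IHn]; rewrite ?expr0 // exprS; apply: PM.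
Qed.

Lemma subring_nat n : P n%:R.
Proof.
have [P1 _ _] := sP; elim: n => [|n IHn]; first exact: subring_0.
by rewrite -addn1 natrD; apply: subring_add.
Qed.

Lemma subring_sum (I : Type) (r : seq I) (F : I -> R) :
  (forall i, P (F i)) -> P (\sum_(i <- r) F i).
Proof.
move=> PF; apply: (big_ind P) => // [|x y Px Py]; first exact: subring_0.
exact: subring_add.
Qed.

End SubringTheory.

Lemma power_reduce (R : pzRingType) (b : R) k :
  b ^+ k.+2 = b -> forall j, exists i : 'I_k.+2, b ^+ j = b ^+ i.
Proof.
move=> bk; elim/ltn_ind=> j IHj; case: (ltnP j k.+2) => [ltj|lej].
  by exists (Ordinal ltj).
have [|i Ei] := IHj (j - k.+2).+1; first
  by rewrite subnS prednK ?subn_gt0 // ltn_subrL (leq_trans _ lej).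
exists i; rewrite -Ei -{1}(subnK lej) exprD bk -exprSr //.
Qed.

(** * Adjoining a potent normalizing element to a finite subring *)

Section Adjoin.

Variables (R : pzRingType) (s : seq R) (b : R) (k : nat).
Hypotheses (sS : is_subring (fun x => x \in s)) (bk : b ^+ k.+2 = b).
Hypothesis b_normal :
  forall t, t \in s -> exists2 t', t' \in s & b * t = t' * b.

Let lin (x : R) : Prop := exists f : {ffun 'I_k.+2 -> seq_sub s},
  x = \sum_(i < k.+2) val (f i) * b ^+ i.

Let lin_of (F : 'I_k.+2 -> R) : (forall i, F i \in s) ->
  lin (\sum_(i < k.+2) F i * b ^+ i).
Proof.
move=> Fs; exists [ffun i => SeqSub (Fs i)].
by apply: eq_bigr => i _; rewrite ffunE.
Qed.

Let lin_monomial t j : t \in s -> lin (t * b ^+ j).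
Proof.
move=> ts; have [i ->] := power_reduce bk j.
pose F l := if l == i then t else 0.
suff -> : t * b ^+ i = \sum_(l < k.+2) F l * b ^+ l.
  by apply: lin_of => l; rewrite /F; case: eqP => // _; exact: (subring_0 sS).
rewrite (bigD1 i) //= /F eqxx big1 ?addr0 // => l /negPf->.
by rewrite mul0r.
Qed.

Let b_exp_normal j t :
  t \in s -> exists2 t', t' \in s & b ^+ j * t = t' * b ^+ j.
Proof.
elim: j t => [|j IHj] t ts; first by exists t; rewrite // mul1r mulr1.
have [t1 t1s E1] := b_normal ts; have [t2 t2s E2] := IHj _ t1s.
by exists t2; rewrite // !exprSr -mulrA E1 !mulrA E2.
Qed.

Let lin_subring : is_subring lin.
Proof.
have [s1 sB sM] := sS.
have linB x y : lin x -> lin y -> lin (x - y).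
  move=> [f ->] [g ->]; rewrite -sumrB.
  under eq_bigr do rewrite -mulrBl.
  by apply: lin_of => i; apply: sB; exact: valP.
have lin0 : lin 0.
  by have := lin_monomial 0 (subring_0 sS); rewrite mul0r.
have linD x y : lin x -> lin y -> lin (x + y).
  by move=> lx ly; rewrite -[y]opprK -[- y]sub0r; apply: (linB);
    rewrite //; exact: linB.
split=> //; first by rewrite -(mulr1 1); exact: (lin_monomial 0).
move=> x y [f ->] [g ->]; rewrite mulr_suml.
apply: (big_ind lin) => // i _; rewrite mulr_sumr.
apply: (big_ind lin) => // j _.
have [t ts Et] := b_exp_normal i (valP (g j)).
rewrite -mulrA [_ ^+ i * _]mulrA Et -!mulrA -exprD mulrA.
by apply/lin_monomial/sM => //; exact: valP.
Qed.

(** Normality moves [b] to the right of coefficients and [power_reduce] bounds its exponent, so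
    combinations of [1, b, ..., b ^+ k.+1] over [s] are closed under products. There are finitely
    many, as [seq_sub s] is finite. The last clause says that [s'] is generated by [s] and [b]; it
    serves as an induction principle. *)
Lemma adjoin_finite : exists s' : seq R,
  [/\ is_subring (fun x => x \in s'), {subset s <= s'}, b \in s'
    & forall P : R -> Prop, is_subring P -> (forall t, t \in s -> P t) -> P b ->
        forall x, x \in s' -> P x].
Proof.
pose ev (f : {ffun 'I_k.+2 -> seq_sub s}) := \sum_(i < k.+2) val (f i) * b ^+ i.
pose s' := [seq ev f | f <- enum {ffun 'I_k.+2 -> seq_sub s}].
have s'P x : x \in s' <-> lin x.
  split=> [/mapP[f _ ->]|[f ->]]; first by exists f.
  by apply/mapP; exists f; rewrite // mem_enum.
have [l1 lB lM] := lin_subring; have [s1 sB sM] := sS.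
exists s'; split.
- split; first exact/s'P.
  + by move=> x y /s'P lx /s'P ly; apply/s'P/lB.
  + by move=> x y /s'P lx /s'P ly; apply/s'P/lM.
- by move=> t ts; apply/s'P; have := lin_monomial 0 ts; rewrite mulr1.
- by apply/s'P; have := lin_monomial 1 s1; rewrite mul1r.
move=> P sP sub Pb x /s'P[f ->]; apply: subring_sum => // i.
have [_ _ PM] := sP; apply: PM; last exact: subring_exp.
by apply: sub; exact: valP.
Qed.

End Adjoin.

(** * Idempotents and characteristic of potent rings *)

Section PotentRing.

Variable R : pzRingType.
Hypothesis potR : potent_ring R.

Lemma potent_reduced (x : R) : x * x = 0 -> x = 0.
Proof. by move=> xx; have [k <-] := potR x; rewrite !exprS mulrA xx mul0r. Qed.

(** Both [e * x * (1 - e)] and [(1 - e) * x * e] square to zero, hence vanish. *)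
Lemma potent_idem_central (e x : R) : e * e = e -> e * x = x * e.
Proof.
move=> ee; have e0 : (1 - e) * e = 0 by rewrite mulrBl mul1r ee subrr.
have e0' : e * (1 - e) = 0 by rewrite mulrBr mulr1 ee subrr.
have h1 : e * x * (1 - e) = 0.
  by apply: potent_reduced; rewrite !mulrA -[_ * (1 - e) * e]mulrA e0
    mulr0 !mul0r.
have h2 : (1 - e) * x * e = 0.
  by apply: potent_reduced; rewrite !mulrA -[_ * e * (1 - e)]mulrA e0'
    mulr0 !mul0r.
rewrite mulrBr mulr1 in h1; rewrite mulrBl mul1r mulrBl in h2.
by rewrite (subr0_eq h1) (subr0_eq h2).
Qed.

Lemma potent_idem (x : R) :
  exists2 y, y * x * (y * x) = y * x & x * (y * x) = x.
Proof.
have [k xk] := potR x; exists (x ^+ k); rewrite -exprSr.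
  by rewrite -exprD addSn -addnS addnC exprD xk exprSr -exprS exprSr.
by rewrite -exprS xk.
Qed.

Lemma annihilator_ideal (e : R) :
  (forall x, e * x = x * e) -> two_sided_ideal (fun x => e * x = 0).
Proof.
move=> ec; split=> [|x y ex ey|a x ex|a x ex].
- by rewrite mulr0.
- by rewrite mulrBr ex ey subr0.
- by rewrite mulrA ec -mulrA ex mulr0.
- by rewrite mulrA ex mul0r.
Qed.

Lemma potent_char : exists2 c, (0 < c)%N & c%:R = 0 :> R.
Proof.
have [k /eqP] := potR 2%:R; rewrite -natrX -subr_eq0 -natrB; last first.
  by rewrite -{1}(expn1 2) leq_exp2l.
by move/eqP=> c0; exists (2 ^ k.+2 - 2)%N; rewrite //
  subn_gt0 -{1}(expn1 2) ltn_exp2l.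
Qed.

Lemma potent_prime_subring : exists s : seq R,
  is_subring (fun x => x \in s) /\ forall x, x \in s -> exists n, x = n%:R.
Proof.
have [c c0 cR] := potent_char.
have natE n : n%:R = (n %% c)%:R :> R.
  by rewrite {1}(divn_eq n c) natrD natrM cR mulr0 add0r.
exists [seq i%:R : R | i <- iota 0 c].
have inP (x : R) :
    reflect (exists n, x = n%:R) (x \in [seq i%:R | i <- iota 0 c]).
  apply: (iffP mapP) => [[i _ ->]|[n ->]]; first by exists i.
  by exists (n %% c)%N; [rewrite mem_iota add0n ltn_mod | exact: natE].
split; last by move=> x /inP.
split; first by apply/inP; exists 1%N.
  (* Modulo [c], this natural number represents the difference of [m] and [n]. *)
  move=> _ _ /inP[m ->] /inP[n ->]; apply/inP; exists (m + (c - n %% c))%N.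
  by rewrite natrD natrB 1?ltnW ?ltn_mod // cR sub0r -natE.
by move=> _ _ /inP[m ->] /inP[n ->]; apply/inP; exists (m * n)%N; rewrite natrM.
Qed.

End PotentRing.

(** * Making finitely many elements zero or invertible *)

Lemma potent_quotient (R S : pzRingType) (f : {rmorphism R -> S}) :
  potent_ring R -> (forall y, exists x, y = f x) -> potent_ring S.
Proof.
move=> potR fsurj y; have [x ->] := fsurj y; have [k xk] := potR x.
by exists k; rewrite -rmorphXn xk.
Qed.

(* Killing the annihilator of the idempotent [e] attached to [x], or that of
   [1 - e], whichever does not meet [z], makes [x] invertible or zero. *)
Lemma potent_localize (R : pzRingType) (l : seq R) (z : R) :
  potent_ring R -> z != 0 ->
  exists (S : pzRingType) (f : {rmorphism R -> S}),
    [/\ potent_ring S, f z != 0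
      & forall x, x \in l -> f x = 0 \/ exists y, y * f x = 1].
Proof.
have [n sz] : exists n, size l = n by exists (size l).
elim: n R l sz z => [|n IHn] R [|x l] //= sz z potR z0.
  by exists R, idfun.
(* Being zero or left invertible survives morphisms, so the elements of the list can be treated one
   at a time. *)
suff [S [f [potS fz0 fx]]] : exists (S : pzRingType) (f : {rmorphism R -> S}),
    [/\ potent_ring S, f z != 0 & f x = 0 \/ exists y, y * f x = 1].
  have szl : size (map f l) = n by rewrite size_map; exact: succn_inj.
  have [T [g [potT gz0 gl]]] := IHn S (map f l) szl _ potS fz0.
  exists T, (g \o f); split=> // u; rewrite inE => /predU1P[->|ul] /=.
    case: fx => [->|[y yx]]; first by left; rewrite rmorph0.
    by right; exists (g y); rewrite -rmorphM yx rmorph1.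
  by apply: gl; exact: map_f.
have [y ee xe] := potent_idem potR x; set e := y * x in ee xe.
have ec := potent_idem_central potR _ ee.
have ec' u : (1 - e) * u = u * (1 - e) by rewrite mulrBl mulrBr ec mul1r mulr1.
have [ez0|ez0] := eqVneq (e * z) 0; last first.
  have [S [f [kerf fsurj]]] := quotient_ring_exists (annihilator_ideal ec).
  exists S, f; split; first exact: potent_quotient fsurj.
    by apply: contra_neq ez0 => /kerf.
  right; exists (f y); rewrite -rmorphM -/e; apply/eqP.
  rewrite -subr_eq0 -(rmorph1 f) -rmorphB; apply/eqP/kerf.
  by rewrite mulrBr mulr1 ee subrr.
have [S [f [kerf fsurj]]] := quotient_ring_exists (annihilator_ideal ec').
exists S, f; split; first exact: potent_quotient fsurj.
  apply: contra_neq z0 => /kerf.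
  by rewrite mulrBl mul1r ez0 subr0.
by left; apply/kerf; rewrite ec' mulrBr mulr1 xe subrr.
Qed.

(** * Finite subrings that are fields *)

Section FiniteDomain.

Variables (R : pzRingType) (s : seq R).
Hypotheses (sS : is_subring (fun x => x \in s)) (nz1 : 1 != 0 :> R).
Hypothesis s_inv : forall x, x \in s -> x = 0 \/ exists y, y * x = 1.

(* The proofs are parameters so that the ring instances on [F] can use them. *)
Definition fin_subring (_ : is_subring (fun x => x \in s)) (_ : 1 != 0 :> R) :=
  seq_sub s.
Local Notation F := (fin_subring sS nz1).

Lemma fin_subring_closed : subring_closed (mem s).
Proof. by have [s1 sB sM] := sS; split. Qed.

HB.instance Definition _ := SubChoice.on F.
HB.instance Definition _ := Finite.on F.
HB.instance Definition _ :=
  GRing.SubChoice_isSubPzRing.Build R (mem s) F fin_subring_closed.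

Lemma fin_subring_nz : 1 != 0 :> F.
Proof. by rewrite -val_eqE. Qed.

HB.instance Definition _ := GRing.PzSemiRing_isNonZero.Build F fin_subring_nz.
HB.instance Definition _ := FinRing.isNzRing.Build F.

(** The left inverse is only known to lie in [R], so the cancellation takes place there. *)
Lemma fin_subring_domain : GRing.integral_domain_axiom F.
Proof.
move=> x y xy0; have [x0|[u ux]] := s_inv (valP x).
  by apply/orP; left; apply/eqP/val_inj.
apply/orP; right; apply/eqP/val_inj; rewrite -[LHS]mul1r -ux -mulrA.
by rewrite -[_ * _ in X in _ * X](rmorphM (val : F -> R)) xy0 mulr0.
Qed.

(** [FinDomainFieldType] carries Wedderburn's little theorem, which makes the finite domain
    commutative. *)
Lemma finite_field_of_subring :
  exists (K : finFieldType) (f : {rmorphism K -> R}),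
  forall x, x \in s <-> exists u, x = f u.
Proof.
exists (FinDomainFieldType fin_subring_domain), (val : {rmorphism F -> R}) => x.
split=> [xs|[u ->]]; last exact: (valP (u : seq_sub s)).
by exists (SeqSub xs : F).
Qed.

End FiniteDomain.

(** * Eigenvectors of right multiplication over a finite field *)

Section TwistedEval.

Variables (K : fieldType) (R : pzRingType) (f : {rmorphism K -> R}) (a : R).

(** This is [p] evaluated at the operator of right multiplication by [a], applied to [z], with
    scalars of [K] acting on the left through [f]. The two actions commute, even if [a] and [f c] do
    not. *)
Definition twisted_eval (z : R) (p : {poly K}) : R :=
  \sum_(i < size p) f p`_i * z * a ^+ i.

Lemma twisted_eval_wide z (p : {poly K}) n : (size p <= n)%N ->
  twisted_eval z p = \sum_(i < n) f p`_i * z * a ^+ i.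
Proof.
move=> le_p_n; rewrite /twisted_eval.
rewrite (big_ord_widen n (fun i => f p`_i * z * a ^+ i)) //.
rewrite big_mkcond; apply: eq_bigr => i _; case: ltnP => // le_p_i.
by rewrite nth_default // rmorph0 !mul0r.
Qed.

Lemma twisted_evalB z (p q : {poly K}) :
  twisted_eval z (p - q) = twisted_eval z p - twisted_eval z q.
Proof.
pose n := maxn (size p) (size q).
have le_pq : (size (p - q)%R <= n)%N.
  by rewrite (leq_trans (size_polyD _ _)) // size_polyN.
rewrite !(@twisted_eval_wide _ _ n) ?leq_maxl ?leq_maxr // -sumrB.
by apply: eq_bigr => i _; rewrite coefB rmorphB !mulrBl.
Qed.

Lemma twisted_evalXn z n : twisted_eval z 'X^n = z * a ^+ n.
Proof.
rewrite /twisted_eval size_polyXn big_ord_recr big1 /= => [|i _].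
  by rewrite add0r coefXn eqxx rmorph1 mul1r.
by rewrite coefXn ltn_eqF // rmorph0 !mul0r.
Qed.

Lemma twisted_eval_mulXsubC z c (p : {poly K}) :
  twisted_eval z (('X - c%:P) * p) = twisted_eval (z * a - f c * z) p.
Proof.
rewrite (@twisted_eval_wide _ _ (size p).+1); last first.
  by rewrite (leq_trans (size_polyMleq _ _)) // size_XsubC.
rewrite (@twisted_eval_wide _ p (size p).+1) //.
transitivity (\sum_(i < (size p).+1) f ('X * p)`_i * z * a ^+ i -
              \sum_(i < (size p).+1) f p`_i * (f c * z) * a ^+ i).
  rewrite -sumrB; apply: eq_bigr => i _.
  by rewrite mulrBl coefB coefCM rmorphB !mulrBl [c * _]mulrC rmorphM !mulrA.
rewrite big_ord_recl coefXM /= rmorph0 !mul0r add0r.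
transitivity (\sum_(i < (size p).+1) f p`_i * (z * a) * a ^+ i -
              \sum_(i < (size p).+1) f p`_i * (f c * z) * a ^+ i).
  (* The extra top term has coefficient zero, leaving the sum shifted by ['X]. *)
  congr (_ - _); rewrite big_ord_recr /= nth_default // rmorph0 !mul0r addr0.
  by apply: eq_bigr => i _; rewrite coefXM /= exprS !mulrA.
by rewrite -sumrB; apply: eq_bigr => i _; rewrite mulrBr mulrBl.
Qed.

(** Apply the linear factors to [z] in turn: the vector just before the first zero is the
    eigenvector. *)
Lemma twisted_eigenvector (l : seq K) (z : R) :
  z != 0 -> twisted_eval z (\prod_(c <- l) ('X - c%:P)) = 0 ->
  exists c y, [/\ c \in l, y != 0 & y * a = f c * y].
Proof.
elim: l z => [|c l IHl] z z0.
  by rewrite big_nil -(expr0 'X) twisted_evalXn mulr1 => /eqP/idPn.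
rewrite big_cons twisted_eval_mulXsubC.
have [zc _|zc /(IHl _ zc)[c' [y [c'l y0 yc']]]] := eqVneq (z * a - f c * z) 0.
  by exists c, z; split; rewrite ?mem_head //; apply: subr0_eq.
by exists c', y; split; rewrite // inE c'l orbT.
Qed.

End TwistedEval.

(* ['X^#|K| - 'X] is both the product of the ['X - c%:P] and a twisted
   annihilator of every [b]; the factor at [a] maps [b] to a nonzero element. *)
Lemma finite_field_eigenvector (K : finFieldType) (R : pzRingType)
    (f : {rmorphism K -> R}) (a : K) (b : R) :
  f a * b != b * f a ->
  exists c y, [/\ c != a, y != 0 & y * f a = f c * y].
Proof.
move=> ab; pose l := rem a (enum K).
have z0 : b * f a - f a * b != 0 by rewrite subr_eq0 eq_sym.
have [|c [y [cl y0 yc]]] := @twisted_eigenvector K R f (f a) l _ z0.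
  rewrite -twisted_eval_mulXsubC.
  rewrite -(big_cons _ _ _ _ xpredT (fun c => 'X - c%:P)).
  rewrite -(perm_big _ (perm_to_rem (mem_enum K a))) big_enum.
  rewrite -finField_genPoly /=.
  by rewrite twisted_evalB -['X]expr1 !twisted_evalXn -rmorphXn expf_card subrr.
exists c, y; split=> //; apply: contraTneq cl => ->.
by rewrite /l mem_rem_uniq ?enum_uniq // !inE eqxx.
Qed.

(** * Jacobson's commutativity theorem and finite subrings *)

Lemma subring_image (R S : pzRingType) (f : {rmorphism R -> S}) (s : seq R) :
  is_subring (fun x => x \in s) -> is_subring (fun y => y \in map f s).
Proof.
move=> [s1 sB sM]; split; first by rewrite -(rmorph1 f) map_f.
  by move=> _ _ /mapP[x xs ->] /mapP[y ys ->]; rewrite -rmorphB map_f ?sB.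
by move=> _ _ /mapP[x xs ->] /mapP[y ys ->]; rewrite -rmorphM map_f ?sM.
Qed.

Lemma potent_localize_field (R : pzRingType) (s : seq R) (z : R) :
  potent_ring R -> is_subring (fun x => x \in s) -> z != 0 ->
  exists (S : pzRingType) (g : {rmorphism R -> S})
         (K : finFieldType) (f : {rmorphism K -> S}),
    [/\ potent_ring S, g z != 0
      & forall y, y \in map g s <-> exists u, y = f u].
Proof.
move=> potR sS z0; have [S [g [potS gz0 sinv]]] := potent_localize s potR z0.
have nz1 : 1 != 0 :> S.
  by apply: contra_neq gz0 => S0; rewrite -[g z]mul1r S0 mul0r.
have sinv' y : y \in map g s -> y = 0 \/ exists u, u * y = 1.
  by move=> /mapP[x xs ->]; exact: sinv.
have [K [f Kf]] := finite_field_of_subring (subring_image g sS) nz1 sinv'.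
by exists S, g, K, f.
Qed.

Lemma potent_adjoin_commuting (R : pzRingType) (s : seq R) (b : R) :
  potent_ring R -> is_subring (fun x => x \in s) ->
  (forall t, t \in s -> b * t = t * b) ->
  exists s' : seq R,
  [/\ is_subring (fun x => x \in s'), {subset s <= s'}, b \in s'
    & forall P : R -> Prop, is_subring P -> (forall t, t \in s -> P t) -> P b ->
        forall x, x \in s' -> P x].
Proof.
move=> potR sS bc; have [k bk] := potR b.
by apply: adjoin_finite sS bk _ => t ts; exists t; rewrite ?bc.
Qed.

Theorem potent_commutative (R : pzRingType) :
  potent_ring R -> forall x y : R, x * y = y * x.
Proof.
move=> potR x y; apply/eqP; case: eqP => // /eqP; rewrite -subr_eq0 => z0.
have [s0 [s0S s0P]] := potent_prime_subring potR.
have [|s1 [s1S s01 xs1 s1ind]] := potent_adjoin_commuting (b := x) potR s0S.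
  by move=> t /s0P[n ->]; rewrite mulr_natl mulr_natr.
have [S [g [K [f [potS gz0 Kf]]]]] := potent_localize_field potR s1S z0.
have /Kf[a ga] := map_f g xs1.
have [|c [w [ca w0 wa]]] := @finite_field_eigenvector K S f a (g y).
  by rewrite -subr_eq0 -ga -!rmorphM -rmorphB.
have [k wk] := potS w.
have tS := subring_image g s1S.
(* That [w] normalizes the image of [s1] is checked on generators: multiples of [1] commute with
   [w], and the image of [x] is carried to [f c]. *)
have [|s2 [s2S s12 ws2 _]] := adjoin_finite tS wk.
  move=> _ /mapP[t ts ->].
  apply: (s1ind (fun t => exists2 t', t' \in map g s1 & w * g t = t' * w)) t ts.
  - have [t1 tB tM] := tS; split.
    + by exists 1; rewrite // rmorph1 mul1r mulr1.
    + move=> u v [u' u's Eu] [v' v's Ev]; exists (u' - v'); first exact: tB.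
      by rewrite rmorphB mulrBr mulrBl Eu Ev.
    + move=> u v [u' u's Eu] [v' v's Ev]; exists (u' * v'); first exact: tM.
      by rewrite rmorphM mulrA Eu -!mulrA Ev.
  - move=> t /s0P[n ->]; exists n%:R; first exact: (subring_nat tS).
    by rewrite rmorph_nat mulr_natl mulr_natr.
  - by exists (f c); [apply/Kf; exists c | rewrite ga].
(* The commutator is [f (a - c) * w], and [a - c] is invertible in [K]. *)
have z2 : f a * w - w * f a != 0.
  rewrite wa -mulrBl -rmorphB; apply: contra_neq w0 => aw.
  have ac : a - c != 0 by rewrite subr_eq0 eq_sym.
  by rewrite -[w]mul1r -(rmorph1 f) -(mulVf ac) rmorphM -mulrA aw mulr0.
have [T [h [L [e [_ hz0 Le]]]]] := potent_localize_field potS s2S z2.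
have /Le[u hu] := map_f h ws2.
have fas : f a \in s2 by apply/s12; rewrite -ga map_f.
have /Le[v hv] := map_f h fas.
by case/eqP: hz0; rewrite rmorphB !rmorphM hu hv -!rmorphM mulrC subrr.
Qed.

Lemma potent_finite_subring (R : pzRingType) (l : seq R) :
  potent_ring R -> exists s : seq R,
    is_subring (fun x => x \in s) /\ {subset l <= s}.
Proof.
move=> potR; elim: l => [|b l [s [sS ls]]].
  by have [s [sS _]] := potent_prime_subring potR; exists s.
have [|s' [s'S ss' bs' _]] := potent_adjoin_commuting (b := b) potR sS.
  by move=> t _; exact: potent_commutative.
exists s'; split=> // x; rewrite inE => /predU1P[->|/ls/ss'] //.
Qed.

(** * Periodic rings, nilpotent perturbations and matrix powers *)

Lemma periodic_lt (R : pzRingType) (x : R) :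
  periodic R -> exists m n, [/\ (0 < m)%N, (m < n)%N & x ^+ m = x ^+ n].
Proof.
move=> /(_ x)[m [n [m0 n0 nmn E]]].
by have [ltmn|ltnm|/nmn] := ltngtP m n; [exists m, n | exists n, m |].
Qed.

Lemma periodic_char (R : pzRingType) :
  periodic R -> exists2 c, (0 < c)%N & c%:R = 0 :> R.
Proof.
move=> /(periodic_lt 2%:R)[m [n [_ lt_mn]]]; rewrite -!natrX => E.
exists (2 ^ n - 2 ^ m)%N; first by rewrite subn_gt0 ltn_exp2l.
by rewrite natrB ?E ?subrr // leq_exp2l // ltnW.
Qed.

Lemma periodic_sub_potent (R : pzRingType) (x : R) :
  periodic R -> exists k, Defs.Nil (x ^+ k.+2 - x).
Proof.
move=> /(periodic_lt x)[m [n [m0 lt_mn E]]].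
(* The difference is [x * (x ^+ (n - m) - 1)]; its power [m] contains the factor [x ^+ m * (x ^+ (n
   - m) - 1) = x ^+ n - x ^+ m = 0]. *)
exists (n - m).-1, m; split=> //.
rewrite prednK ?subn_gt0 // exprS -[X in _ - X]mulr1 -mulrBr.
have cx : GRing.comm x (x ^+ (n - m) - 1).
  by apply: commrB; [exact: commrX | exact: commr1].
rewrite exprMn_comm // -(prednK m0) [in X in _ * X]exprS mulrA prednK //.
by rewrite mulrBr mulr1 -exprD subnKC ?(ltnW lt_mn) // -E subrr mul0r.
Qed.

Lemma exprD_nilpotent (R : pzRingType) (x d : R) K c :
  GRing.comm x d -> d ^+ K = 0 -> c%:R = 0 :> R ->
  (x + d) ^+ (c * K`!) = x ^+ (c * K`!).
Proof.
move=> cxd dK c0; rewrite exprDn_comm // big_ord_recl /= subn0 bin0 mulr1.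
rewrite mulr1n big1 ?addr0 // => i _; rewrite /bump leq0n add1n.
case: (leqP K i.+1) => [leK|ltK].
  by rewrite -(subnKC leK) exprD dK mul0r mulr0 mul0rn.
(* With [M = c * K!] and [j = i + 1 < K], use [j * 'C(M, j) = M * 'C(M - 1, j - 1)] and that [j]
   divides [K!]. *)
have [q ->] : exists q, 'C((c * K`!)%N, i.+1) = (c * q)%N.
  have iK : (i.+1 %| K`!)%N by rewrite dvdn_fact // ltn0Sn ltnW.
  exists ((K`! %/ i.+1) * 'C((c * K`!)%N.-1, i))%N.
  apply/eqP; rewrite -(eqn_pmul2l (ltn0Sn i)) -mul_bin_diag.
  by rewrite mulnCA [(i.+1 * _)%N]mulnA [(i.+1 * _)%N]mulnC divnK // mulnA.
by rewrite mulrnA -[X in X *+ q]mulr_natr c0 mulr0 mul0rn.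
Qed.

Lemma matrix_nilpotent (R : pzRingType) (I : R -> Prop) n (D : 'M[R]_n) :
  locally_nilpotent I -> (forall i j, I (D i j)) ->
  exists2 K, (0 < K)%N & D ^+ K = 0.
Proof.
move=> locI ID; pose s := [seq D ij.1 ij.2 | ij <- enum {: 'I_n * 'I_n}].
have Ds i j : D i j \in s by apply/mapP; exists (i, j); rewrite ?mem_enum.
have [|K [K0 sK]] := locI s; first by move=> _ /mapP[ij _ ->].
exists K => //.
(* The left factor [u] accumulates the entries already split off from the power of [D]. *)
suff DK m u :
    (forall t : m.-tuple R, {subset t <= s} -> u * \prod_(x <- t) x = 0) ->
    forall i j, u * (D ^+ m) i j = 0.
  apply/matrixP => i j; rewrite mxE -[LHS]mul1r; apply: DK => t ts.
  by rewrite mul1r sK.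
elim: m u => [|m IHm] u us i j.
  have := us [tuple]; rewrite big_nil mulr1 => -> //.
  by rewrite mul0r.
rewrite exprS mxE mulr_sumr big1 // => k _; rewrite mulrA.
apply: IHm => t ts; rewrite -mulrA -(big_cons _ _ _ _ xpredT id).
apply: (us [tuple of D i k :: t]) => x; rewrite inE => /predU1P[->//|].
exact: ts.
Qed.

Lemma matrix_powers_repeat (T : pzRingType) (s : seq T) n (A : 'M[T]_n) :
  is_subring (fun x => x \in s) -> (forall i j, A i j \in s) ->
  exists p q : nat, (p < q)%N /\ A ^+ p.+1 = A ^+ q.+1.
Proof.
move=> sS As.
have Aps m i j : (A ^+ m) i j \in s.
  elim: m i j => [|m IHm] i j.
    by rewrite expr0 mxE; exact: (subring_nat sS).
  rewrite exprS mxE; apply: (subring_sum sS) => k.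
  by have [_ _ sM] := sS; apply: sM.
pose B m : 'M[seq_sub s]_n := \matrix_(i, j) SeqSub (Aps m i j).
have BA m : map_mx val (B m) = A ^+ m by apply/matrixP => i j; rewrite !mxE.
pose N := #|{: 'M[seq_sub s]_n}|.
(* Pigeonhole on [N.+1] powers among [N] matrices; the shift keeps exponents positive. *)
have /injectivePn[i [j nij Eij]] : ~~ injectiveb (fun i : 'I_N.+1 => B i.+1).
  by apply/negP => /injectiveP /leq_card; rewrite card_ord ltnn.
have E : A ^+ i.+1 = A ^+ j.+1 by rewrite -!BA Eij.
case: (ltngtP i j) => [ltij|ltji|/val_inj eij]; first by exists i, j.
  by exists j, i.
by rewrite eij eqxx in nij.
Qed.

Theorem theorem2p4 (R : pzRingType) (hw : weakly_2_primal R)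
  (hp : periodic R) (n : nat) (hn : (1 <= n)%N) : periodic 'M[R]_n.
Proof.
case: hw => L [[idL locL _] NilL].
suff per (A : 'M[R]_n) : exists k l : nat,
    [/\ (0 < k)%N, (0 < l)%N, k <> l & A ^+ k = A ^+ l] by exact: per.
have [Q [f [kerf fsurj]]] := quotient_ring_exists idL.
have potQ : potent_ring Q.
  move=> y; have [x ->] := fsurj y.
  have [k /NilL/kerf] := periodic_sub_potent x hp.
  by rewrite rmorphB rmorphXn => /subr0_eq; exists k.
have [s [sS As]] :=
  potent_finite_subring [seq f (A ij.1 ij.2) | ij <- enum {: 'I_n * 'I_n}] potQ.
have [|p [q [ltpq Epq]]] := matrix_powers_repeat (A := map_mx f A) sS.
  by move=> i j; rewrite mxE; apply/As/mapP; exists (i, j); rewrite ?mem_enum.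
pose D := A ^+ q.+1 - A ^+ p.+1.
have [|K K0 DK] := @matrix_nilpotent R L n D locL.
  (* The two powers agree over [Q], so the entries of [D] lie in the kernel [L] of [f]. *)
  move=> i j; apply/kerf.
  have -> : f (D i j) = (map_mx f D) i j by rewrite [RHS]mxE.
  by rewrite rmorphB !rmorphXn /= Epq subrr mxE.
have [c c0 cR] := periodic_char hp.
have cM : c%:R = 0 :> 'M[R]_n.
  by apply/matrixP => i j; rewrite mulmxnE -mulr_natr cR mulr0 mxE.
have cAD : GRing.comm (A ^+ p.+1) D.
  by apply: commrB; apply: commrX; apply/commr_sym/commrX.
have := exprD_nilpotent cAD DK cM.
(* Here [A ^+ p.+1 + D] is turned back into [A ^+ q.+1]. *)
rewrite [_ + D]addrC subrK -!exprM => E.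
have M0 : (0 < c * K`!)%N by rewrite muln_gt0 c0 fact_gt0.
exists (q.+1 * (c * K`!))%N, (p.+1 * (c * K`!))%N.
split=> //; last apply/eqP; rewrite ?(muln_gt0 _.+1) //.
by rewrite eqn_pmul2r // eqSS gtn_eqF.
Qed.
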